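(* Let $t\in\mathbb{N}$ be odd and let $0\le t_1<t_2<t$ be integers such that $t_1\not\equiv t_2 \pmod p$ for all primes $p$ with $p\mid t$. Then there are a cycle $\alpha\in S_t$ of length $t$ and a permutation $\beta\in S_t$ which is a product of disjoint $2$-cycles such that $l_\infty(\beta,\alpha^{t_1})\le 1$ and $l_\infty(\beta,\alpha^{t_2})\le 1$.
   Context: $S_t$ is the symmetric group on $\{1,\dots,t\}$; $i^\pi$ denotes the image of $i$ under $\pi\in S_t$. The $l_\infty$ distance of $\tau,\pi\in S_t$ is $l_\infty(\tau,\pi)=\max_{1\le i\le t}|i^\tau-i^\pi|$. *)

(* Defs.v *)
From mathcomp Require Import all_boot all_order all_algebra all_fingroup.

Set Implicit Arguments.
Unset Strict Implicit.
Unset Printing Implicit Defensive.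

(* S_t is 'S_t, acting on {0, ..., t-1}; the shift from {1, ..., t} leaves all
   differences of points unchanged. *)

Definition linf_dist (t : nat) (tau pi : 'S_t) : nat :=
  \max_(i < t) `|tau i - pi i|%N.

(* [next s] fixes the points outside [s], so this says that [alpha] is the
   cycle (s_0 s_1 ... s_(k-1)). *)
Definition is_cycle_of_length (t k : nat) (alpha : 'S_t) : Prop :=
  exists s : seq 'I_t,
    [/\ uniq s, size s = k & forall i : 'I_t, alpha i = next s i].

(* Uniqueness of the flattened list says both that each pair consists of two
   distinct points and that distinct pairs are disjoint. *)
Definition is_product_of_disjoint_2cycles (t : nat) (beta : 'S_t) : Prop :=
  exists s : seq ('I_t * 'I_t),
    uniq (flatten [seq [:: ab.1; ab.2] | ab <- s]) /\
    beta = (\prod_(ab <- s) tperm ab.1 ab.2)%g.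

(* Main.v *)
(** Identify the points with Z/t by the "folding" 0, 2, 4, ..., 5, 3, 1, which
    displaces by at most one position when z is replaced by -z or by -1 - z.
    The difference t2 - t1 is invertible mod t, with inverse u say.  Let alpha
    be the translation by u and beta the reflection x |-> -1 - u t1 - x, seen
    through the folding: then beta x = -1 - z for z = alpha^t1 x, and
    beta x = -w for w = alpha^t2 x = z + 1. *)

Require Import Defs.
From mathcomp Require Import all_boot all_order all_algebra all_fingroup.
From mathcomp Require Import zify.

Set Implicit Arguments.
Unset Strict Implicit.
Unset Printing Implicit Defensive.

(** Induction on the number of moved points: each step splits off the transposition of a moved point
    and its image. *)
Lemma involution_product_of_disjoint_2cycles (t : nat) (b : 'S_t) :
  involutive b -> is_product_of_disjoint_2cycles b.
Proof.
(* The induction also records that every listed point is moved; this keeps a newly added pair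
   disjoint from the others. *)
suff main m : #|[pred x | b x != x]| <= m -> involutive b ->
    exists s : seq ('I_t * 'I_t),
      [/\ uniq (flatten [seq [:: ab.1; ab.2] | ab <- s]),
          {in flatten [seq [:: ab.1; ab.2] | ab <- s], forall x, b x != x} &
          b = (\prod_(ab <- s) tperm ab.1 ab.2)%g].
  by case/(main _ (leqnn _)) => s [Us _ Eb]; exists s.
elim: m b => [|m IHm] b le_m bK.
  exists [::]; split=> //; rewrite big_nil; apply/permP=> x; rewrite perm1.
  move: le_m; rewrite leqn0 => /eqP/card0_eq/(_ x).
  by rewrite inE => /negbFE/eqP.
have [x bx | bid] := pickP [pred x | b x != x]; last first.
  exists [::]; split=> //; rewrite big_nil; apply/permP=> x; rewrite perm1.
  by have /= /negbFE/eqP := bid x.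
rewrite /= in bx.
(* [c] fixes [x] and [b x] and agrees with [b] elsewhere, so it is an involution with fewer moved
   points. *)
pose c := (tperm x (b x) * b)%g.
have cx : c x = x by rewrite permM tpermL bK.
have cbx : c (b x) = b x by rewrite permM tpermR.
have cE y : y != x -> y != b x -> c y = b y.
  by move=> yx ybx; rewrite permM tpermD // eq_sym.
have moved_c y : c y != y -> b y != y.
  have [-> | yx] := eqVneq y x; first by rewrite cx eqxx.
  have [-> | ybx] := eqVneq y (b x); first by rewrite cbx eqxx.
  by rewrite cE.
have cK : involutive c.
  move=> y; have [-> | yx] := eqVneq y x; first by rewrite !cx.
  have [-> | ybx] := eqVneq y (b x); first by rewrite !cbx.
  rewrite (cE y) // cE ?bK ?(inj_eq perm_inj) //.
  by apply: contraNneq ybx => <-; rewrite bK.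
have le_c : #|[pred y | c y != y]| <= m.
  rewrite -ltnS; apply: leq_trans le_m; apply: proper_card.
  apply/properP; split; first by apply/subsetP=> y; rewrite !inE; apply: moved_c.
  by exists x; rewrite !inE ?cx ?eqxx.
have [s [Us Ms Ec]] := IHm c le_c cK.
exists ((x, b x) :: s); split=> /=.
- rewrite Us inE eq_sym (negPf bx) andbT /=.
  by apply/andP; split; apply/negP=> /Ms; rewrite ?cx ?cbx eqxx.
- move=> y; rewrite !inE => /or3P[/eqP-> | /eqP-> | /Ms /moved_c //] //.
  by rewrite bK eq_sym.
- by rewrite big_cons -Ec mulgA tperm2 mul1g.
Qed.

(** The orbit of [x], listed in order of iteration, is the required cycle; transitivity makes it
    exhaust all points. *)
Lemma transitive_is_cycle (t : nat) (a : 'S_t) (x : 'I_t) :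
  (forall y, exists k, (a ^+ k)%g x = y) -> is_cycle_of_length t a.
Proof.
move=> a_trans.
have a_all y : y \in fingraph.orbit a x.
  by rewrite -fconnect_orbit; have [k <-] := a_trans y; rewrite permX fconnect_iter.
exists (fingraph.orbit a x); split=> [||i]; first exact: orbit_uniq.
  rewrite size_orbit /fingraph.order -[RHS]card_ord; apply: eq_card => y.
  by rewrite inE fconnect_orbit a_all.
by apply/eqP; exact: next_cycle (cycle_orbit perm_inj x) (a_all i).
Qed.

Definition fold_nat (t z : nat) : nat :=
  if 2 * z < t then 2 * z else 2 * (t - z) - 1.

Lemma fold_nat_lt (t z : nat) : z < t -> fold_nat t z < t.
Proof. rewrite /fold_nat; case: ifP; lia. Qed.

Definition fold_ord (t : nat) (z : 'I_t) : 'I_t :=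
  Ordinal (fold_nat_lt (ltn_ord z)).

Lemma fold_ord_inj (t : nat) : injective (@fold_ord t).
Proof.
move=> [x ltx] [y lty] /(congr1 val) /=; rewrite /fold_nat => E.
apply: val_inj; move: E => /=; do 2!case: ifP; lia.
Qed.

Definition fold_perm (t : nat) : 'S_t := perm (@fold_ord_inj t).

Section Cyclic.

Variable n : nat.
Local Notation Z := 'I_n.+2.
Local Notation f := (fold_perm n.+2).

Import GRing.Theory.
Local Open Scope ring_scope.

(** With t = [n.+2]: either both residues are 0, or they are z and t - z with 2z <= t, which sit at
    positions 2z and 2z - 1 or coincide. *)
Lemma fold_perm_opp (a b : Z) : a + b = 0 -> (`|f a - f b| <= 1)%N.
Proof.
move=> /(congr1 val) /= E; rewrite !permE /= /fold_nat.
have {E} : (a + b = 0 \/ a + b = n.+2)%N.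
  have [lt_ab | le_ab] := ltnP (a + b) n.+2; first by left; rewrite modn_small in E.
  right; move: E; rewrite -(subnK le_ab) modnDr modn_small; first by lia.
  by have := ltn_ord a; have := ltn_ord b; lia.
by have := ltn_ord a; have := ltn_ord b; do 2!case: ifP; lia.
Qed.

(** Here the residues are z and t - 1 - z with 2z <= t - 1, which sit at positions 2z and 2z + 1 or
    coincide. *)
Lemma fold_perm_oppS (a b : Z) : a + b = -1 -> (`|f a - f b| <= 1)%N.
Proof.
move=> E; have {E} : a + b + 1 = 0 by rewrite E addNr.
move=> /(congr1 val) /=; rewrite modnDml modnDmr => E; rewrite !permE /= /fold_nat.
(* The sum lies strictly between 0 and 2t, so divisibility by t leaves one value. *)
have {E} : (a + b + 1 = n.+2)%N.
  have [lt_ab | le_ab] := ltnP (a + b + 1) n.+2.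
    by move: E; rewrite modn_small //; lia.
  move: E; rewrite -(subnK le_ab) modnDr modn_small; first by lia.
  by have := ltn_ord a; have := ltn_ord b; lia.
by have := ltn_ord a; have := ltn_ord b; do 2!case: ifP; lia.
Qed.

(** The map x -> x + u is inferred from its injectivity proof, as is x -> c - x in [reflection]. *)
Definition translation (u : Z) : 'S_n.+2 := perm (addIr u).

Definition reflection (c : Z) : 'S_n.+2 := perm (subrI c).

Lemma translationX (u x : Z) (k : nat) : (translation u ^+ k)%g x = x + u *+ k.
Proof.
elim: k => [|k IHk]; first by rewrite expg0 perm1 addr0.
by rewrite expgSr permM IHk permE mulrSr addrA.
Qed.

Lemma conj_translation_is_cycle (u v : Z) (g : 'S_n.+2) :
  u * v = 1 -> is_cycle_of_length n.+2 (translation u ^ g)%g.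
Proof.
move=> uv1; apply: (@transitive_is_cycle _ _ (g 0)) => y.
(* The residue v z, with z the preimage of [y] under [g], is read as a number of steps: from 0 they
   lead to u v z = z. *)
exists (v * (g^-1)%g y)%R; rewrite -conjXg permJ translationX add0r.
by rewrite -mulr_natr natr_Zp mulrA uv1 mul1r permKV.
Qed.

Lemma conj_reflection_involutive (c : Z) (g : 'S_n.+2) :
  involutive (reflection c ^ g)%g.
Proof.
by move=> x; rewrite -[x](permKV g) !permJ !permE subKr.
Qed.

(** Conjugation by [f] relabels the points: [r ^ f] sends [f x] to [f (r x)]. *)
Lemma linf_dist_conj_fold (r s : 'S_n.+2) :
    (forall x, (`|f (r x) - f (s x)| <= 1)%N) ->
  (linf_dist (r ^ f)%g (s ^ f)%g <= 1)%N.
Proof.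
move=> near_rs; apply/bigmax_leqP=> i _.
by rewrite -[i](permKV f) !permJ.
Qed.

End Cyclic.

(** A prime factor of the gcd would divide [t] and make [t1] and [t2] congruent. *)
Lemma coprime_subn (t t1 t2 : nat) :
    0 < t -> t1 <= t2 ->
    (forall p : nat, prime p -> p %| t -> t1 <> t2 %[mod p]) ->
  coprime t (t2 - t1).
Proof.
move=> t_gt0 le12 neq12; rewrite /coprime eqn_leq gcdn_gt0 t_gt0 andbT leqNgt.
apply/negP=> gcd_gt1; have p_dvd := pdiv_dvd (gcdn t (t2 - t1)).
apply: (neq12 _ (pdiv_prime gcd_gt1)).
  exact: dvdn_trans p_dvd (dvdn_gcdl _ _).
by apply/esym/eqP; rewrite eqn_mod_dvd //; apply: dvdn_trans p_dvd (dvdn_gcdr _ _).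
Qed.

Theorem theorem5 (t t1 t2 : nat) :
  odd t -> t1 < t2 -> t2 < t ->
  (forall p : nat, prime p -> p %| t -> t1 <> t2 %[mod p]) ->
  exists (alpha beta : 'S_t),
    [/\ is_cycle_of_length t alpha,
        is_product_of_disjoint_2cycles beta,
        linf_dist beta (alpha ^+ t1)%g <= 1 &
        linf_dist beta (alpha ^+ t2)%g <= 1].
Proof.
(* The bounds force [t] to be at least 2, so that ['I_n.+2] is the ring Z/t. *)
move=> _; case: t => [|[|n]] lt12 ltt2 neq12; [lia | lia |].
have co_d := coprime_subn (ltn0Sn _) (ltnW lt12) neq12.
pose d : 'I_n.+2 := (t2 - t1)%:R%R.
have d_unit : d \is a GRing.unit by rewrite (@unitZpE n.+2).
pose u : 'I_n.+2 := (d^-1)%R.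
have ud1 : (u * d = 1)%R by rewrite GRing.mulVr.
have u12 : (u *+ t2 = u *+ t1 + 1)%R.
  by rewrite -ud1 GRing.mulr_natr -GRing.mulrnDr subnKC // ltnW.
exists (translation u ^ fold_perm n.+2)%g.
exists (reflection (- 1 - u *+ t1)%R ^ fold_perm n.+2)%g.
split.
- exact: conj_translation_is_cycle ud1.
- exact/involution_product_of_disjoint_2cycles/conj_reflection_involutive.
- rewrite -conjXg; apply: linf_dist_conj_fold => x; apply: fold_perm_oppS.
  by rewrite translationX permE GRing.addrA GRing.subrK GRing.subrK.
- rewrite -conjXg; apply: linf_dist_conj_fold => x; apply: fold_perm_opp.
  by rewrite translationX permE u12 !GRing.addrA !GRing.subrK GRing.addNr.
Qed.
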